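(* Assume $\pi\ge0$ and that the manufacturer reports truthfully, i.e. $\mathbf r=\mathbf r^{id}$ (the identity matrix), so $\hat\Phi_t=\Phi_t$ for all $t$. Then, for every $j$, almost surely $$\bar D_{j,t}\to\sqrt\alpha\,h_{jj}=\frac{\phi_j-\alpha(C_s+C_m)}{4}.$$ Moreover, the manufacturer's revenue rate satisfies, almost surely, $$\lim_{t\to\infty}\frac1t\sum_{s\le t}D_s\,(P_s-Q_s-C_m)=\frac{1}{16\alpha}\sum_{i=1}^L\sigma_i\big(\phi_i-\alpha(C_s+C_m)\big)^2 .$$ This limit does not depend on $\pi$.
   Context: Supply-chain model. The parameters are a price-sensitivity $\alpha\in(0,1]$, a manufacturer's per-unit production cost $C_m\ge0$, and a supplier's per-unit procurement cost $C_s\ge0$. For $x\in\mathbb R$ write $x^+=\max\{0,x\}$. The market potential takes values $\phi_1<\dots<\phi_L$ with probabilities $\sigma_1,\dots,\sigma_L>0$ summing to $1$, and $\phi_1>\alpha(C_s+C_m)$. Set $$h_{ij}=\frac{2\phi_i-\phi_j-\alpha(C_m+C_s)}{4\sqrt\alpha},\qquad q^*(\phi)=\frac{\phi+\alpha(C_s-C_m)}{2\alpha}.$$ Dynamic system. Let $\mathbf r=(r_{ij})$ be an $L\times L$ stochastic matrix. The pairs $(\Phi_t,\hat\Phi_t)$, $t=1,2,\dots$, are i.i.d. with $P(\Phi_t=\phi_i,\hat\Phi_t=\phi_j)=\sigma_i r_{ij}$. Here $\Phi_t$ is the true potential in slot $t$ and $\hat\Phi_t$ is the reported one. The noises $\{\mathcal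 N_t\}$ are i.i.d., bounded, have zero mean, and are independent of $\{(\Phi_t,\hat\Phi_t)\}$. Fix a penalty parameter $\pi$ and, for each $j$, an arbitrary initial value $\bar D_{j,0}\in\mathbb R$. For $t\ge1$, define $\bar D_{j,t}$ as the average of $D_s$ over the slots $s\le t$ with $\hat\Phi_s=\phi_j$, namely $$\bar D_{j,t}=\frac{\sum_{s\le t}D_s\mathbf 1\{\hat\Phi_s=\phi_j\}}{\sum_{s\le t}\mathbf 1\{\hat\Phi_s=\phi_j\}}.$$ If no such slot exists yet, set $\bar D_{j,t}=\bar D_{j,0}$. In slot $t$, if $\hat\Phi_t=\phi_j$, the supplier quotes $$Q_t=q^*(\phi_j)+2\pi\big(\bar D_{j,t-1}-\sqrt\alpha\,h_{jj}\big).$$ The manufacturer then sets $$P_t=\frac{\Phi_t+\alpha(Q_t+C_m)}{2\alpha},$$ and the realized demand is $$D_t=(\Phi_t-\alpha P_t)^++\mathcal N_t .$$ *)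

(* Defs.v *)
From HB Require Import structures.
From mathcomp Require Import all_boot all_order all_algebra.
From mathcomp Require Import all_classical all_reals all_analysis.
Set Implicit Arguments.
Unset Strict Implicit.
Unset Printing Implicit Defensive.
Import numFieldNormedType.Exports.
Import Order.TTheory GRing.Theory Num.Theory.
Local Open Scope classical_set_scope.
Local Open Scope ring_scope.

Definition mutually_independent {d} {T : measurableType d} {R : realType}
  (P : probability T R) (I : eqType) (E : I -> set (set T)) : Prop :=
  forall (s : seq I) (A : I -> set T), uniq s ->
    (forall i, i \in s -> E i (A i)) ->
    P (\big[setI/setT]_(i <- s) A i) = (\prod_(i <- s) P (A i))%E.

Definition rv_events {d} {T : measurableType d} {d'} {V : measurableType d'}
  (X : T -> V) : set (set T) :=
  [set A | exists B : set V, measurable B /\ A = X @^-1` B].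

(* The dynamic supply-chain system, for ONE realisation (omega fixed). *)
(* Slots are t = 1,2,...; the data of slot t is stored at index t-1:    *)
(*   ph k  = Phi_{k+1},  phh k = hat Phi_{k+1},  nz k = N_{k+1}.        *)
Section Model.
Variables (R : realType) (alpha Cm Cs pen : R) (L : nat).
Variables (phis : 'I_L -> R) (Dbar0 : 'I_L -> R).
Variables (ph phh nz : nat -> R).

Definition xplus (x : R) : R := Num.max 0 x.

Definition hh (i j : 'I_L) : R :=
  (2 * phis i - phis j - alpha * (Cm + Cs)) / (4 * Num.sqrt alpha).

Definition qstar (x : R) : R := (x + alpha * (Cs - Cm)) / (2 * alpha).

(* Dbar_{j,.} computed from the list ds = [D_1; ...; D_n] of past demands *)
Definition dbar_of (ds : seq R) (j : 'I_L) : R :=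
  let cnt := \sum_(s < size ds | phh s == phis j) (1 : R) in
  if cnt == 0 then Dbar0 j
  else (\sum_(s < size ds | phh s == phis j) nth 0 ds s) / cnt.

(* supplier's quote in slot k+1, given past demands ds of slots 1..k.
   If the report is not one of the phi_j (a null event) the quote is
   q*(report), arbitrarily. *)
Definition quote_of (k : nat) (ds : seq R) : R :=
  match [pick j : 'I_L | phh k == phis j] with
  | Some j => qstar (phis j) + 2 * pen * (dbar_of ds j - Num.sqrt alpha * hh j j)
  | None => qstar (phh k)
  end.

Definition price_of (x q : R) : R := (x + alpha * (q + Cm)) / (2 * alpha).

Definition demand_of (k : nat) (ds : seq R) : R :=
  xplus (ph k - alpha * price_of (ph k) (quote_of k ds)) + nz k.

Fixpoint hist (n : nat) : seq R :=
  match n with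
  | 0 => [::]
  | n'.+1 => rcons (hist n') (demand_of n' (hist n'))
  end.

(* quantities of slot k+1 *)
Definition Qslot (k : nat) : R := quote_of k (hist k).
Definition Pslot (k : nat) : R := price_of (ph k) (Qslot k).
Definition Dslot (k : nat) : R := demand_of k (hist k).

Definition Dbar (j : 'I_L) (t : nat) : R := dbar_of (hist t) j.

Definition revenue_rate (t : nat) : R :=
  t%:R^-1 * \sum_(k < t) Dslot k * (Pslot k - Qslot k - Cm).

End Model.

(* Main.v *)
(* In a slot with truthful report phi_j the noiseless demand is
   (m_j - alpha pen (Dbar_j - m_j))^+, where m_j = sqrt(alpha) h_jj.  So, apart
   from the noise, the sum of D - m_j over these slots is always pushed back
   towards 0 by bounded steps; it is therefore of the order of the running
   maximum of the accumulated noise, which is o(t) by the strong law.  As the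
   slots have frequency sigma_j > 0, this gives Dbar_j -> m_j, and the revenue
   rate follows by Cesaro averaging, the noise entering only through its
   averages over the slots of each type.

   The strong law is needed for bounded orthogonal variables only, where
   E[(S_{n^2}/n^2)^2] <= M^2/n^2 is summable and |S_t - S_{n^2}| is at most 2nM
   for n^2 <= t < (n+1)^2.  Orthogonality comes from independence by
   approximating a bounded variable uniformly by a combination of indicators. *)
Require Import Defs.
From HB Require Import structures.
From mathcomp Require Import all_boot all_order all_algebra.
From mathcomp Require Import all_classical all_reals all_analysis.
From mathcomp Require Import measurable_realfun ring lra.
Import numFieldNormedType.Exports.
Import Order.TTheory GRing.Theory Num.Theory.
Local Open Scope classical_set_scope.
Local Open Scope ring_scope.
Set Implicit Arguments.
Unset Strict Implicit.
Unset Printing Implicit Defensive.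

(** * Sequences of order o(t) *)

Section Sublinear.
Variable R : realType.
Implicit Types S Z G u : nat -> R.

(** Means S t = o(t). The constant [C] absorbs the early terms, so that the bound holds at every [t]
    and can be proved by induction from 0. *)
Definition sublinear S :=
  forall e : R, 0 < e -> exists C, forall t, `|S t| <= C + e * t%:R.

Lemma eq_sublinear S S' : S =1 S' -> sublinear S -> sublinear S'.
Proof.
by move=> SS' subS e e0; have [C SC] := subS e e0; exists C => t; rewrite -SS'.
Qed.

Lemma sublinear0 : sublinear (fun=> 0).
Proof. by move=> e e0; exists 0 => t; rewrite normr0 add0r mulr_ge0// ltW. Qed.

Lemma sublinearD S Z :
  sublinear S -> sublinear Z -> sublinear (fun t => S t + Z t).
Proof.
move=> subS subZ e e0; have e20 : 0 < e / 2 by rewrite divr_gt0.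
have [C SC] := subS _ e20; have [B ZB] := subZ _ e20.
exists (C + B) => t; apply: le_trans (ler_normD _ _) _.
by have := SC t; have := ZB t; lra.
Qed.

Lemma sublinearZ (a : R) S : sublinear S -> sublinear (fun t => a * S t).
Proof.
move=> subS e e0; have a0 : 0 < `|a| + 1 by rewrite ltr_wpDl.
have [|C SC] := subS (e / (`|a| + 1)); first by rewrite divr_gt0.
exists ((`|a| + 1) * C) => t; rewrite normrM.
apply: (@le_trans _ _ ((`|a| + 1) * `|S t|)).
  by rewrite ler_wpM2r// lerDl.
have := SC t; rewrite -(ler_pM2l a0) mulrDr => /le_trans; apply.
by rewrite lerD2l mulrA mulrCA divff ?mulr1// gt_eqF.
Qed.

Lemma sublinear_sum (I : Type) (r : seq I) (S : I -> nat -> R) :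
  (forall i, sublinear (S i)) -> sublinear (fun t => \sum_(i <- r) S i t).
Proof.
move=> subS; elim: r => [|i r IH].
  by apply: eq_sublinear sublinear0 => t; rewrite big_nil.
by apply: eq_sublinear (sublinearD (subS i) IH) => t; rewrite big_cons.
Qed.

Lemma cvg_div_sublinear S :
  sublinear S -> t%:R^-1 * S t @[t --> \oo] --> (0 : R).
Proof.
move=> subS; apply/cvgrPdist_le => e e0.
have e20 : 0 < e / 2 by rewrite divr_gt0.
have [C SC] := subS _ e20; near=> t.
have t0 : 0 < t%:R :> R by rewrite ltr0n; near: t; exact: nbhs_infty_gt.
rewrite sub0r normrN normrM normfV normr_nat ler_pdivrMl//.
have : C / (e / 2) <= t%:R by near: t; exact: nbhs_infty_ger.
by rewrite ler_pdivrMr// => Ct; have := SC t; lra.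
Unshelve. all: by end_near. Qed.

Lemma sublinear_near S :
  (forall e, 0 < e -> \forall t \near \oo, `|S t| <= e * t%:R) -> sublinear S.
Proof.
move=> nearS e e0; have [n _ Sn] := nearS e e0.
exists (\sum_(k < n) `|S k|) => t.
have sum0 : 0 <= \sum_(k < n) `|S k| by apply: sumr_ge0.
have [tn|nt] := ltnP t n; last first.
  by apply: (le_trans (Sn t _)) => //; rewrite lerDr.
rewrite (bigD1 (Ordinal tn))//= -addrA lerDl addr_ge0//.
  by apply: sumr_ge0.
by rewrite mulr_ge0// ltW.
Qed.

Lemma cesaro_sublinear u :
  u t @[t --> \oo] --> (0 : R) -> sublinear (fun t => \sum_(k < t) u k).
Proof.
move=> /cvgrPdist_le u0 e e0; have [n _ un] := u0 e e0.
exists (\sum_(k < n) `|u k|) => t.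
apply: (le_trans (ler_norm_sum _ _ _)).
elim: t => [|t IH]; first by rewrite big_ord0 mulr0 addr0 sumr_ge0.
rewrite big_ord_recr/=; have [tn|nt] := ltnP t n; last first.
  have := un t nt; rewrite sub0r normrN => ut.
  by rewrite -natr1 mulrDr mulr1 addrA lerD.
rewrite -(big_ord_recr t (fun k => `|u k|))/=.
apply: (@le_trans _ _ (\sum_(k < n) `|u k|)).
  rewrite -(subnKC tn) big_split_ord/= lerDl; exact: sumr_ge0.
by rewrite lerDl mulr_ge0// ltW.
Qed.

(* A step of [G] opposes the sign of [Z + G] and has size at most [K]: so once
   [G] leaves the range of [Z] it is pushed back, and it can overshoot that
   range by at most one step. *)
Lemma sublinear_restoring Z G (K : R) :
  0 <= K -> G 0%N = 0 ->
  (forall t, `|G t.+1 - G t| <= K) ->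
  (forall t, 0 < Z t + G t -> G t.+1 <= G t) ->
  (forall t, Z t + G t < 0 -> G t <= G t.+1) ->
  sublinear Z -> sublinear (fun t => Z t + G t).
Proof.
move=> K0 G0 stepG downG upG subZ; apply: sublinearD => // e e0.
have [C ZC] := subZ e e0; exists (C + K) => t.
elim: t => [|t IH].
  by rewrite G0 normr0; have := ZC 0%N; have := normr_ge0 (Z 0%N); lra.
have := ZC t; have := stepG t; have := downG t; have := upG t; move: IH.
rewrite -natr1 mulrDr mulr1; set B := e * t%:R.
rewrite !ler_norml => /andP[G1 G2] up down /andP[s1 s2] /andP[z1 z2].
(* A positive [Z t + G t] gives [G t > - Z t], so one step down, of size at most [K], stays above
   [-(C + K + B)], and the upper bound is inherited; negative values are symmetric. At 0, [G t] is
   as small as [Z t]. *)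
have [zg|zg|zg] := ltgtP (Z t + G t) 0.
- by have := up zg; lra.
- by have := down zg; lra.
- by lra.
Qed.

End Sublinear.

(** * A strong law of large numbers *)

Section BoundedRandomVariables.
Context {d : measure_display} {T : measurableType d} {R : realType}.
Variable P : probability T R.
Implicit Types X Y : T -> R.

Definition bounded_rv X :=
  measurable_fun setT X /\ exists M, forall w, `|X w| <= M.

Lemma bounded_rv_cst (c : R) : bounded_rv (fun=> c).
Proof. by split; [exact: measurable_cst|exists `|c|]. Qed.

Lemma bounded_rv_indic (A : set T) : measurable A -> bounded_rv \1_A.
Proof.
move=> mA; split; first exact: measurable_indic.
by exists 1 => w; rewrite indicE ger0_norm// lern1 leq_b1.
Qed.

Lemma bounded_rvD X Y :
  bounded_rv X -> bounded_rv Y -> bounded_rv (fun w => X w + Y w).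
Proof.
move=> [mX [M XM]] [mY [N YN]]; split; first exact: measurable_funD.
by exists (M + N) => w; apply: le_trans (ler_normD _ _) (lerD _ _).
Qed.

Lemma bounded_rvM X Y :
  bounded_rv X -> bounded_rv Y -> bounded_rv (fun w => X w * Y w).
Proof.
move=> [mX [M XM]] [mY [N YN]]; split; first exact: measurable_funM.
by exists (M * N) => w; rewrite normrM ler_pM.
Qed.

Lemma bounded_rv_sum (I : Type) (r : seq I) (X : I -> T -> R) :
  (forall i, bounded_rv (X i)) -> bounded_rv (fun w => \sum_(i <- r) X i w).
Proof.
move=> bX; elim: r => [|i r IH].
  by under eq_fun do rewrite big_nil; exact: bounded_rv_cst.
by under eq_fun do rewrite big_cons; exact: bounded_rvD.
Qed.

Lemma integrable_bounded_rv X :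
  bounded_rv X -> P.-integrable setT (EFin \o X).
Proof.
move=> [mX [M XM]]; apply: measurable_bounded_integrable => //.
  exact: le_lt_trans (probability_le1 P measurableT) (ltry 1).
exists M; split; first exact: num_real.
by move=> N MN w _; apply: le_trans (XM w) (ltW MN).
Qed.

Lemma mean_cst (c : R) : \int[P]_w c = c.
Proof. by rewrite Rintegral_cst// [X in fine X]probability_setT mulr1. Qed.

Lemma mean_indic (A : set T) :
  measurable A -> \int[P]_w \1_A w = fine (P A).
Proof. by move=> mA; rewrite /Rintegral integral_indic// setIT. Qed.

Lemma meanD X Y : bounded_rv X -> bounded_rv Y ->
  \int[P]_w (X w + Y w) = \int[P]_w X w + \int[P]_w Y w.
Proof. by move=> bX bY; rewrite RintegralD//; exact: integrable_bounded_rv. Qed.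

Lemma meanZ (c : R) X : bounded_rv X ->
  \int[P]_w (c * X w) = c * \int[P]_w X w.
Proof. by move=> bX; rewrite RintegralZl//; exact: integrable_bounded_rv. Qed.

Lemma mean_sum (I : Type) (r : seq I) (X : I -> T -> R) :
  (forall i, bounded_rv (X i)) ->
  \int[P]_w (\sum_(i <- r) X i w) = \sum_(i <- r) \int[P]_w X i w.
Proof.
move=> bX; elim: r => [|i r IH].
  by under eq_Rintegral do rewrite big_nil; rewrite mean_cst big_nil.
under eq_Rintegral do rewrite big_cons.
by rewrite meanD ?IH ?big_cons//; exact: bounded_rv_sum.
Qed.

Lemma le_mean X Y : bounded_rv X -> bounded_rv Y ->
  (forall w, X w <= Y w) -> \int[P]_w X w <= \int[P]_w Y w.
Proof.
by move=> bX bY XY; apply: le_Rintegral => //; exact: integrable_bounded_rv.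
Qed.

Lemma norm_mean X (M : R) : bounded_rv X -> (forall w, `|X w| <= M) ->
  `|\int[P]_w X w| <= M.
Proof.
move=> bX XM.
have iX := integrable_bounded_rv bX.
apply: (le_trans (le_normr_Rintegral measurableT iX)).
rewrite -[leRHS]mean_cst; apply: le_mean => //; last exact: bounded_rv_cst.
have [mX [N XN]] := bX; split; first exact: measurableT_comp.
by exists N => w; rewrite normr_id.
Qed.

(** [a] times the sum is [y] rounded down to a multiple of [a]: the sum counts the levels [a], [2a],
    ... reached by [y]. *)
Lemma staircase_approx (a y : R) n : 0 < a -> 0 <= y <= n%:R * a ->
  `|y - a * \sum_(k < n) (k.+1%:R * a <= y)%R%:R| <= a.
Proof.
move=> a0; elim: n => [|n IH] /andP[y0 yn].
  rewrite big_ord0 mulr0 subr0 (_ : y = 0) ?normr0 ?ltW//.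
  by apply/le_anti; rewrite y0 (le_trans yn)// mul0r.
rewrite big_ord_recr/=; have [ny|ny] := leP (n.+1%:R * a) y.
  have -> : y = n.+1%:R * a by apply/le_anti; rewrite ny yn.
  rewrite (eq_bigr (fun=> 1)) => [|k _]; last first.
    by rewrite ler_pM2r// ler_nat ltnS ltnW.
  by rewrite sumr_const card_ord -natr1 mulrC subrr normr0 ltW.
rewrite addr0; have [yn'|yn'] := leP y (n%:R * a).
  by apply: IH; rewrite y0.
rewrite (eq_bigr (fun=> 1)) => [|k _]; last first.
  by rewrite (le_trans _ (ltW yn'))// ler_pM2r// ler_nat.
rewrite sumr_const card_ord ger0_norm; move: ny; rewrite -natr1; nra.
Qed.

(* [Y] is uniformly close to linear combinations of the indicators of its
   upper level sets. *)
Lemma mean_orthogonal X Y : bounded_rv X -> bounded_rv Y ->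
  (forall c : R, \int[P]_w (X w * \1_(Y @^-1` `[c, +oo[) w) = 0) ->
  \int[P]_w (X w * Y w) = 0.
Proof.
move=> bX bY X0; have [_ [K XK]] := bX; have [mY [M YM]] := bY.
(* At level [- M] the upper level set of [Y] is the whole space. *)
have EX0 : \int[P]_w X w = 0.
  rewrite -(X0 (- M)); apply: eq_Rintegral => w _.
  rewrite indicE mem_set ?mulr1//= in_itv/= andbT.
  by have := YM w; rewrite ler_norml => /andP[].
apply/eqP; rewrite -normr_le0; apply/ler_addgt0Pl => e e0; rewrite addr0.
have K0 : 0 < `|K| + 1 by rewrite ltr_wpDl.
(* Mesh chosen so that [|X w * D w|] is at most [e]; the [1] keeps the divisor positive. *)
pose a := e / (`|K| + 1); have a0 : 0 < a by rewrite divr_gt0.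
(* The levels of mesh [a] have to cover [[0, M + M]], where [Y + M] takes its values. *)
pose n := (Num.truncn ((M + M) / a)).+1.
have Ma : M + M <= n%:R * a by rewrite -ler_pdivrMr// ltW// truncnS_gt.
pose A (k : 'I_n) := Y @^-1` `[k.+1%:R * a - M, +oo[.
have mA k : measurable (A k).
  by rewrite -[A k]setTI; apply: mY => //; exact: measurable_itv.
have bXA k : bounded_rv (fun w => X w * \1_(A k) w).
  by apply: bounded_rvM => //; exact: bounded_rv_indic.
pose D w := Y w + M - a * \sum_(k < n) \1_(A k) w.
have DE w : D w = (Y w + M) - a * \sum_(k < n) (k.+1%:R * a <= Y w + M)%R%:R.
  congr (_ - a * _); apply: eq_bigr => k _; rewrite indicE; congr (_%:R).
  have -> : (w \in A k) = (k.+1%:R * a - M <= Y w).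
    by apply/idP/idP; rewrite ?inE /A/= in_itv/= andbT.
  by rewrite lerBlDr.
have bD : bounded_rv D.
  rewrite /D; apply: bounded_rvD.
    by apply: bounded_rvD => //; exact: bounded_rv_cst.
  under eq_fun do rewrite -mulNr.
  apply: bounded_rvM; first exact: bounded_rv_cst.
  by apply: bounded_rv_sum => k; exact: bounded_rv_indic.
(* The constant [M] and the staircase are both orthogonal to [X], so [Y] may be replaced by the
   small error [D]. *)
have -> : \int[P]_w (X w * Y w) = \int[P]_w (X w * D w).
  rewrite (@eq_Rintegral _ _ _ P setT (fun w => (X w * D w + - M * X w) +
      a * \sum_(k < n) (X w * \1_(A k) w))); last first.
    by move=> w _; rewrite -mulr_sumr /D; ring.
  have bXD : bounded_rv (fun w => X w * D w) by exact: bounded_rvM.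
  have bMX : bounded_rv (fun w => - M * X w).
    by apply: bounded_rvM => //; exact: bounded_rv_cst.
  have bS : bounded_rv (fun w => \sum_(k < n) (X w * \1_(A k) w)).
    exact: bounded_rv_sum.
  rewrite meanD; [|exact: bounded_rvD|].
    rewrite meanD// !meanZ// mean_sum// EX0 big1 ?mulr0 ?addr0// => k _.
    exact: X0.
  by apply: bounded_rvM => //; exact: bounded_rv_cst.
apply: norm_mean => [|w]; first exact: bounded_rvM.
rewrite normrM; have YMw := YM w; have XKw := XK w.
have Da : `|D w| <= a.
  rewrite DE; apply: staircase_approx => //.
  by move: YMw Ma; rewrite ler_norml => /andP[]; lra.
apply: (@le_trans _ _ ((`|K| + 1) * a)); last first.
  by rewrite mulrCA divff ?mulr1// gt_eqF.
by apply: ler_pM => //; apply: le_trans XKw _; rewrite ler_wpDr// ler_norm.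
Qed.

(* E[S_{n+1}^2] - E[S_n^2] = E[X_n^2] for orthogonal summands. *)
Lemma mean_sqr_sum (X : nat -> T -> R) (M : R) n :
  (forall k, bounded_rv (X k)) -> (forall k w, `|X k w| <= M) ->
  (forall i j, (i < j)%N -> \int[P]_w (X i w * X j w) = 0) ->
  \int[P]_w (\sum_(k < n) X k w) ^+ 2 <= n%:R * M ^+ 2.
Proof.
move=> bX XM XX0; elim: n => [|n IH].
  under eq_Rintegral do rewrite big_ord0 expr0n.
  by rewrite mean_cst mul0r.
have bS : bounded_rv (fun w => \sum_(k < n) X k w) by exact: bounded_rv_sum.
have bSX : bounded_rv (fun w => \sum_(k < n) (X k w * X n w)).
  by apply: bounded_rv_sum => k; exact: bounded_rvM.
have bX2 : bounded_rv (fun w => X n w * X n w) by exact: bounded_rvM.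
have bS2 : bounded_rv (fun w => (\sum_(k < n) X k w) ^+ 2).
  by under eq_fun do rewrite expr2; exact: bounded_rvM.
rewrite (@eq_Rintegral _ _ _ P setT (fun w => ((\sum_(k < n) X k w) ^+ 2 +
    2 * \sum_(k < n) (X k w * X n w)) + X n w * X n w)); last first.
  by move=> w _; rewrite big_ord_recr/= -mulr_suml; ring.
rewrite meanD//; last first.
  by apply: bounded_rvD => //; apply: bounded_rvM => //; exact: bounded_rv_cst.
rewrite meanD//; last by apply: bounded_rvM => //; exact: bounded_rv_cst.
rewrite meanZ// mean_sum => [|k]; last exact: bounded_rvM.
rewrite big1 ?mulr0 ?addr0 => [|k _]; last exact: XX0.
rewrite -natr1 mulrDl mul1r lerD//; apply: (le_trans (ler_norm _)).
by apply: norm_mean => // w; rewrite normrM expr2 ler_pM.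
Qed.

End BoundedRandomVariables.

(** * Square subsequences and the strong law for orthogonal variables *)

Lemma sublinear_square_subsequence (R : realType) (S : nat -> R) (M : R) :
  0 <= M -> (forall t, `|S t.+1 - S t| <= M) ->
  ((n.+1 ^ 2)%:R^-1 * S (n.+1 ^ 2)%N) ^+ 2 @[n --> \oo] --> (0 : R) ->
  sublinear S.
Proof.
move=> M0 stepS /cvgrPdist_le S0; apply: sublinear_near => e e0.
have e20 : 0 < e / 2 by rewrite divr_gt0.
have [n0 _ Sn0] := S0 _ (exprn_gt0 2 e20).
have distS t k : `|S (t + k)%N - S t| <= k%:R * M.
  elim: k => [|k IH]; first by rewrite addn0 subrr normr0 mul0r.
  rewrite addnS -natr1 mulrDl mul1r [leRHS]addrC.
  by rewrite (le_trans (ler_distD (S (t + k)%N) _ _))// lerD.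
have squareS n : (n0 <= n)%N -> `|S (n.+1 ^ 2)%N| <= e / 2 * (n.+1 ^ 2)%:R.
  move=> /Sn0; rewrite sub0r normrN normrX ler_pXn2r ?nnegrE ?(ltW e20)//.
  rewrite normrM normfV normr_nat ler_pdivrMl ?ltr0n ?expn_gt0//.
  by rewrite mulrC.
have squareP t : exists n, (n ^ 2 <= t < n.+1 ^ 2)%N.
  elim: t => [|t [n /andP[nt tn]]]; first by exists 0%N.
  move: tn; rewrite leq_eqVlt => /orP[/eqP tn|tn].
    by exists n.+1; rewrite tn leqnn ltn_exp2r/=.
  by exists n; rewrite tn (leq_trans nt).
(* Beyond [n1] the bound along squares holds and [4 * M <= e * n.+1%:R], which makes the change
   [2 * n.+1 * M] since the last square at most half of [e * t%:R]. *)
pose n1 := maxn n0 (Num.truncn (4 * M / e)).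
exists (n1.+1 ^ 2)%N => // t /= n1t.
have [[|n] /andP[nt tn]] := squareP t.
  by have := leq_ltn_trans n1t tn; rewrite ltn_exp2r.
have n1n : (n1 <= n)%N.
  by have := leq_ltn_trans n1t tn; rewrite ltn_exp2r// !ltnS.
have Mn : 4 * M <= e * n.+1%:R.
  rewrite [leRHS]mulrC -ler_pdivrMr// ltW//.
  apply: (lt_le_trans (truncnS_gt _)).
  by rewrite ler_nat ltnS (leq_trans _ n1n)// leq_maxr.
have tE : (t = n.+1 ^ 2 + (t - n.+1 ^ 2))%N by rewrite subnKC.
have kn : (t - n.+1 ^ 2 <= 2 * n.+1)%N.
  rewrite leq_subLR -ltnS (leq_trans tn)//; apply: eq_leq.
  by rewrite -!mulnn; ring.
have sq := squareS n (leq_trans (leq_maxl _ _) n1n).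
have dS := distS (n.+1 ^ 2)%N (t - n.+1 ^ 2)%N; rewrite -tE in dS.
have kM : (t - n.+1 ^ 2)%:R * M <= (2 * n.+1)%:R * M :> R.
  by rewrite ler_wpM2r// ler_nat.
have nt' : (n.+1 ^ 2)%:R <= t%:R :> R by rewrite ler_nat.
have n0' : 0 <= n.+1%:R :> R by [].
have tri : `|S t| <= `|S t - S (n.+1 ^ 2)%N| + `|S (n.+1 ^ 2)%N|.
  by rewrite (le_trans _ (ler_normD _ _))// subrK.
have M2 : (2 * n.+1)%:R * M <= e / 2 * (n.+1 ^ 2)%:R.
  by rewrite natrM natrX expr2; nra.
have : e * (n.+1 ^ 2)%:R <= e * t%:R by rewrite ler_pM2l.
lra.
Qed.

(** The real partial sums increase and are bounded by the finite extended sum, so the series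
    converges and its terms vanish. *)
Lemma cvg_bounded_nneseries (R : realType) (u : nat -> R) :
  (forall n, 0 <= u n) -> (\sum_(n <oo) (u n)%:E < +oo)%E ->
  u n @[n --> \oo] --> (0 : R).
Proof.
move=> u0 uoo; apply: cvg_series_cvg_0.
have ue0 n : (0 <= (u n)%:E)%E by rewrite lee_fin.
have sfin : (\sum_(n <oo) (u n)%:E)%E \is a fin_num.
  by rewrite ge0_fin_numE// nneseries_ge0.
apply: nondecreasing_is_cvgn.
  by apply/nondecreasing_seqP => n; rewrite /series/= big_nat_recr//= lerDl.
exists (fine (\sum_(n <oo) (u n)%:E)%E) => _ [n _ <-].
rewrite -lee_fin fineK// /series/= -sumEFin.
exact: nneseries_lim_ge.
Qed.

Lemma sum_inv_sqr_le2 (R : realFieldType) n :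
  \sum_(k < n) (k.+1%:R ^+ 2)^-1 <= 2 :> R.
Proof.
case: n => [|n]; first by rewrite big_ord0.
(* The sharper bound telescopes: [1/(a+1)^2 <= 1/a - 1/(a+1)], with difference [1/(a (a+1)^2)]. *)
suff : \sum_(k < n.+1) (k.+1%:R ^+ 2)^-1 <= 2 - n.+1%:R^-1 :> R.
  by move=> /le_trans; apply; rewrite gerBl.
elim: n => [|n IH]; first by rewrite big_ord_recr big_ord0/= expr1n invr1; lra.
rewrite big_ord_recr/= (le_trans (lerD IH (lexx _)))//.
have : 0 < n.+1%:R :> R by [].
rewrite -[n.+2%:R]natr1; set a := n.+1%:R => a0.
rewrite -subr_ge0 (_ : _ - _ = (a * (a + 1) ^+ 2)^-1); last by field; lra.
by rewrite invr_ge0 mulr_ge0 ?sqr_ge0// ltW.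
Qed.

Section StrongLaw.
Context {d : measure_display} {T : measurableType d} {R : realType}.
Variable P : probability T R.

(** The squared averages at times [n.+1 ^ 2] have summable means. By monotone convergence their
    series [F] is integrable, hence finite almost everywhere, and there its terms tend to 0. *)
Lemma strong_law_orthogonal (X : nat -> T -> R) (M : R) :
  (forall k, measurable_fun setT (X k)) -> (forall k w, `|X k w| <= M) ->
  (forall i j, (i < j)%N -> \int[P]_w (X i w * X j w) = 0) ->
  {ae P, forall w, sublinear (fun t => \sum_(k < t) X k w)}.
Proof.
move=> mX XM XX0.
have M0 : 0 <= M by apply: le_trans (XM 0%N point).
have bX k : bounded_rv (X k) by split => //; exists M.
pose S n w := (n.+1 ^ 2)%:R^-1 * \sum_(k < n.+1 ^ 2) X k w.
have bS n : bounded_rv (S n).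
  by apply: bounded_rvM; [exact: bounded_rv_cst|exact: bounded_rv_sum].
have bS2 n : bounded_rv (fun w => S n w ^+ 2).
  by under eq_fun do rewrite expr2; exact: bounded_rvM.
have ES n : \int[P]_w (S n w ^+ 2) <= M ^+ 2 * (n.+1%:R ^+ 2)^-1.
  under eq_Rintegral do rewrite exprMn.
  rewrite meanZ; last first.
    under eq_fun do rewrite expr2.
    by apply: bounded_rvM; exact: bounded_rv_sum.
  rewrite exprVn ler_pdivrMl ?exprn_gt0 ?ltr0n ?expn_gt0//.
  apply: (le_trans (mean_sqr_sum _ bX XM XX0)).
  have : n.+1%:R != 0 :> R by rewrite pnatr_eq0.
  rewrite natrX; set a := n.+1%:R => a0.
  by rewrite le_eqVlt; apply/orP; left; apply/eqP; field.
have mS2 n : measurable_fun setT (fun w => (S n w ^+ 2)%:E).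
  by apply/measurable_EFinP; case: (bS2 n).
have S20 n w : (0 <= (S n w ^+ 2)%:E)%E by rewrite lee_fin sqr_ge0.
pose F w := (\sum_(n <oo) (S n w ^+ 2)%:E)%E.
have F0 w : (0 <= F w)%E by apply: nneseries_ge0.
have iF : P.-integrable setT F.
  apply/integrableP; split.
    by apply: ge0_emeasurable_sum => // n w _ _; exact: S20.
  under eq_integral do rewrite gee0_abs ?F0//.
  rewrite integral_nneseries//.
  apply: (@le_lt_trans _ _ (M ^+ 2 * 2)%:E); last exact: ltry.
  apply: lime_le.
    by apply: is_cvg_nneseries => n _ _; exact: integral_ge0.
  near=> n; rewrite big_mkord.
  rewrite (eq_bigr (fun k : 'I_n => (\int[P]_w (S k w ^+ 2))%:E)); last first.
    move=> k _; rewrite /Rintegral fineK//.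
    exact: integrable_fin_num (integrable_bounded_rv P (bS2 k)).
  rewrite sumEFin lee_fin.
  apply: (@le_trans _ _ (\sum_(k < n) M ^+ 2 * (k.+1%:R ^+ 2)^-1)).
    by apply: ler_sum => k _; exact: ES.
  by rewrite -mulr_sumr ler_wpM2l ?sqr_ge0 ?sum_inv_sqr_le2.
have := integrable_ae measurableT iF; apply: filterS => w /(_ I) Fw.
apply: (@sublinear_square_subsequence _ _ M) => // [t|].
  by rewrite big_ord_recr/= addrAC subrr add0r.
apply: cvg_bounded_nneseries => [n|]; first exact: sqr_ge0.
by rewrite -(ge0_fin_numE (F0 w)).
Unshelve. all: by end_near. Qed.

End StrongLaw.

(** * Orthogonality from independence, and the two strong laws *)

Section IndependentNoise.
Context {d : measure_display} {T : measurableType d} {R : realType}.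
Variable P : probability T R.

(** Serves to discard the null event on which a slot takes none of the listed values: the disjoint
    union of the [F i] has full measure. *)
Lemma ae_exists_of_sum1 n (F : 'I_n -> set T) :
  (forall i, measurable (F i)) -> trivIset setT F ->
  (\sum_(i < n) P (F i) = 1)%E ->
  {ae P, forall w, exists i, F i w}.
Proof.
move=> mF tF F1; pose U := \big[setU/set0]_(i < n) F i.
have mU : measurable U by apply: bigsetU_measurable.
exists (~` U); split; first exact: measurableC.
  by rewrite probability_setC// measure_bigsetU_ord// F1 subee.
move=> w; apply: contra_not; rewrite /U; elim/big_ind : _ => //.
  by move=> A B IA IB [/IA|/IB].
by move=> i _ Fiw; exists i.
Qed.

(** Independence makes the centred indicator [\1_F - p] orthogonal to the upper level sets of [Y],
    hence to [Y]; the term [p * E[Y]] vanishes. *)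
Lemma mean_indic_indep (F : set T) (Y : T -> R) :
  measurable F -> bounded_rv Y -> \int[P]_w Y w = 0 ->
  (forall c : R, P (F `&` Y @^-1` `[c, +oo[) = P F * P (Y @^-1` `[c, +oo[))%E ->
  \int[P]_w (\1_F w * Y w) = 0.
Proof.
move=> mF bY EY0 FY; pose p := fine (P F).
have bF : bounded_rv (\1_F : T -> R) by exact: bounded_rv_indic.
have bp : bounded_rv (fun _ : T => - p) by exact: bounded_rv_cst.
have bFp : bounded_rv (fun w => \1_F w + - p : R) by exact: bounded_rvD.
have bFY : bounded_rv (fun w => \1_F w * Y w : R) by exact: bounded_rvM.
have : \int[P]_w ((\1_F w + - p) * Y w) = 0.
  apply: mean_orthogonal => // c; set C := Y @^-1` _.
  have mC : measurable C.
    by rewrite -[C]setTI; apply: (proj1 bY) => //; exact: measurable_itv.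
  rewrite (@eq_Rintegral _ _ _ P setT
    (fun w => \1_(F `&` C) w + - p * \1_C w)); last first.
    by move=> w _; rewrite !indicI/=; ring.
  have bC : bounded_rv (\1_C : T -> R) by exact: bounded_rv_indic.
  have mFC : measurable (F `&` C) by exact: measurableI.
  rewrite meanD; [|exact: bounded_rv_indic|exact: bounded_rvM].
  rewrite meanZ// !mean_indic// FY fineM ?fin_num_measure//.
  by rewrite mulNr subrr.
rewrite (@eq_Rintegral _ _ _ P setT (fun w => \1_F w * Y w + - p * Y w)).
  by rewrite meanD ?meanZ ?EY0 ?mulr0 ?addr0//; exact: bounded_rvM.
by move=> w _; ring.
Qed.

End IndependentNoise.

Section IndependentSlots.
Context {d dV : measure_display} {T : measurableType d} {V : measurableType dV}.
Context {R : realType}.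
Variables (P : probability T R) (X : nat -> T -> V) (N : nat -> T -> R).
Hypothesis mX : forall t, measurable_fun setT (X t).
Hypothesis indep : mutually_independent P
  (fun k : nat + nat => match k with
     | inl t => rv_events (X t) | inr t => rv_events (N t) end).
Variables (B : set V) (p M : R).
Hypothesis mB : measurable B.
Hypothesis XB : forall t, P (X t @^-1` B) = p%:E.
Hypothesis bN : forall t, bounded_rv (N t).
Hypothesis N_le : forall t w, `|N t w| <= M.
Hypothesis EN0 : forall t, \int[P]_w N t w = 0.

Let E t := X t @^-1` B.

Let mE t : measurable (E t).
Proof. by rewrite -[E t]setTI; exact: mX. Qed.

Let bE t : bounded_rv (\1_(E t) : T -> R).
Proof. exact: bounded_rv_indic. Qed.

(** Centring the indicators by [p] turns pairwise independence of the slots into orthogonality. *)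
Lemma strong_law_frequency :
  {ae P, forall w, sublinear (fun t => \sum_(k < t) (\1_(E k) w - p))}.
Proof.
have bp : bounded_rv (fun _ : T => - p) by exact: bounded_rv_cst.
apply: (@strong_law_orthogonal _ _ _ P
  (fun k w => \1_(E k) w - p) (1 + `|p|)) => [t|t w|i j ij].
- by have [] := bounded_rvD (bE t) bp.
- rewrite (le_trans (ler_normB _ _))// lerD2r indicE ger0_norm//.
  by rewrite lern1 leq_b1.
- have Eij : P (E i `&` E j) = (p * p)%:E.
    have := indep (s := [:: inl i; inl j])
      (A := fun k => match k with inl t => E t | inr t => setT end).
    rewrite !big_cons !big_nil setIT mule1 !XB => -> //=.
    + by rewrite inE andbT; apply/eqP => -[] ij'; rewrite ij' ltnn in ij.
    + by case=> t _; [exists B|exists setT; rewrite preimage_setT].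
  rewrite (@eq_Rintegral _ _ _ P setT (fun w =>
    (\1_(E i `&` E j) w + - p * \1_(E i) w) +
    (- p * \1_(E j) w + p * p))); last first.
    by move=> w _; rewrite !indicI/=; ring.
  have bI : bounded_rv (\1_(E i `&` E j) : T -> R).
    by apply: bounded_rv_indic; exact: measurableI.
  have bZ t : bounded_rv (fun w => - p * \1_(E t) w : R) by exact: bounded_rvM.
  have bpp : bounded_rv (fun _ : T => p * p) by exact: bounded_rv_cst.
  rewrite meanD; [|exact: bounded_rvD|exact: bounded_rvD].
  rewrite meanD// meanD// mean_cst !meanZ//.
  rewrite !mean_indic//; last exact: measurableI.
  by rewrite Eij !XB/=; ring.
Qed.

Lemma strong_law_noise :
  {ae P, forall w, sublinear (fun t => \sum_(k < t) \1_(E k) w * N k w)}.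
Proof.
have M0 : 0 <= M by apply: le_trans (N_le 0%N point).
apply: (@strong_law_orthogonal _ _ _ P
  (fun k w => \1_(E k) w * N k w) M) => [t|t w|i j ij].
- by have [] := bounded_rvM (bE t) (bN t).
- rewrite normrM -[leRHS]mul1r ler_pM// indicE ger0_norm//.
  by rewrite lern1 leq_b1.
have ij' : (i == j) = false by rewrite ltn_eqF.
have mN t (D : set R) : measurable D -> measurable (N t @^-1` D).
  by move=> mD; rewrite -[_ @^-1` _]setTI; exact: (proj1 (bN t)).
have mEij : measurable (E i `&` E j) by exact: measurableI.
(* Independence enters in two stages: [N j] is first replaced by the indicator of an upper level set
   [C]; then [E i], [E j] and [C] merge into one event independent of [N i]. *)
rewrite (@eq_Rintegral _ _ _ P setT
    (fun w => (\1_(E i `&` E j) w * N i w) * N j w)); last first.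
  by move=> w _; rewrite !indicI/=; ring.
apply: mean_orthogonal => // [|c].
  by apply: bounded_rvM => //; exact: bounded_rv_indic.
set C := N j @^-1` _.
have mC : measurable C by apply: mN; exact: measurable_itv.
rewrite (@eq_Rintegral _ _ _ P setT
    (fun w => \1_((E i `&` E j) `&` C) w * N i w)); last first.
  by move=> w _; rewrite !indicI/=; ring.
apply: mean_indic_indep => // [|a]; first exact: measurableI.
set A := N i @^-1` _.
(* One choice of events serves the lists with and without [inr i]; comparing the two product
   formulas splits off the factor [P A]. *)
pose G k := match k with
  | inl t => E t
  | inr t => if t == i then A else if t == j then C else setT end.
have indepG s : uniq s -> P (\big[setI/setT]_(k <- s) G k) =
    (\prod_(k <- s) P (G k))%E.
  move=> us; apply: indep => // -[] t _ /=; first by exists B.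
  have [->|_] := eqVneq t i; first by exists `[a, +oo[%classic.
  have [->|_] := eqVneq t j; first by exists `[c, +oo[%classic.
  by exists setT; rewrite preimage_setT.
have ji : (j == i) = false by rewrite eq_sym.
have uniq4 : uniq [:: inr i; inl i; inl j; inr j : nat + nat].
  by rewrite /= !inE /eq_op/= ij'.
have uniq3 : uniq [:: inl i; inl j; inr j : nat + nat] by case/andP: uniq4.
have GC : G (inr j) = C by rewrite /G ji eqxx.
have GA : G (inr i) = A by rewrite /G eqxx.
have := indepG _ uniq4; have := indepG _ uniq3.
rewrite !big_cons !big_nil GC GA !setIT !mule1 /= !setIA => P3 P4.
by rewrite muleC P3 -P4 [in LHS]setIC !setIA.
Qed.

End IndependentSlots.

(** * One realisation with truthful reports *)

Section TruthfulPath.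
Variables (R : realType) (alpha Cm Cs pen : R) (L : nat).
Variables (phis Dbar0 : 'I_L -> R) (ph phh nz : nat -> R).

Local Notation Dbar := (Dbar alpha Cm Cs pen phis Dbar0 ph phh nz).
Local Notation Dslot := (Dslot alpha Cm Cs pen phis Dbar0 ph phh nz).
Local Notation Qslot := (Qslot alpha Cm Cs pen phis Dbar0 ph phh nz).
Local Notation Pslot := (Pslot alpha Cm Cs pen phis Dbar0 ph phh nz).
Local Notation hist := (hist alpha Cm Cs pen phis Dbar0 ph phh nz).

(** The limit [Num.sqrt alpha * hh alpha Cm Cs phis j j], with the square roots cancelled. *)
Definition target (j : 'I_L) : R := (phis j - alpha * (Cs + Cm)) / 4.

Definition reports (j : 'I_L) (k : nat) : R := (phh k == phis j)%:R.

(* [phi_j - alpha P] in a slot with truthful report [phi_j]. *)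
Definition raw_demand (j : 'I_L) (k : nat) : R :=
  target j - alpha * pen * (Dbar j k - target j).

Lemma size_hist n : size (hist n) = n.
Proof. by elim: n => //= n IH; rewrite size_rcons IH. Qed.

Lemma nth_hist n k : (k < n)%N -> nth 0 (hist n) k = Dslot k.
Proof.
elim: n => //= n IH; rewrite ltnS leq_eqVlt nth_rcons size_hist.
by case: ltngtP => // [kn _|->//]; exact: IH.
Qed.

(** Trades the history list for weighted sums. Index [k] is slot [k.+1], so [Dbar j k] uses only
    demands preceding [Dslot k]. *)
Lemma DbarE j t : Dbar j t =
  if \sum_(k < t) reports j k == 0 then Dbar0 j
  else (\sum_(k < t) reports j k * Dslot k) / \sum_(k < t) reports j k.
Proof.
rewrite /Defs.Dbar /dbar_of size_hist big_mkcond/=.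
rewrite (eq_bigr (fun k : 'I_t => reports j k)); last first.
  by move=> k _; rewrite /reports; case: ifP.
case: ifP => // _; congr (_ / _); rewrite big_mkcond/=.
apply: eq_bigr => k _; rewrite nth_hist// /reports.
by case: ifP => _; rewrite ?mul1r ?mul0r.
Qed.

Hypothesis alpha_gt0 : 0 < alpha.
Hypothesis pen_ge0 : 0 <= pen.
Hypothesis phis_inj : injective phis.
Hypothesis target_gt0 : forall j, 0 < target j.

Lemma sqrt_hhE j : Num.sqrt alpha * hh alpha Cm Cs phis j j = target j.
Proof.
have : Num.sqrt alpha != 0 by rewrite gt_eqF// sqrtr_gt0.
by rewrite /hh /target => ?; field.
Qed.

Lemma QslotE j k : phh k = phis j ->
  Qslot k = qstar alpha Cm Cs (phis j) + 2 * pen * (Dbar j k - target j).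
Proof.
move=> phhk; rewrite /Defs.Qslot /quote_of; case: pickP => [i|/(_ j)].
  by rewrite phhk => /eqP/phis_inj <-; rewrite sqrt_hhE.
by rewrite phhk eqxx.
Qed.

Lemma DslotE j k : ph k = phis j -> phh k = phis j ->
  Dslot k = xplus (raw_demand j k) + nz k.
Proof.
move=> phk phhk; rewrite /Defs.Dslot /demand_of -/(Qslot k) (QslotE phhk) phk.
congr (xplus _ + _); rewrite /price_of /qstar /raw_demand /target.
by field; rewrite gt_eqF.
Qed.

Lemma marginE j k : ph k = phis j -> phh k = phis j ->
  Pslot k - Qslot k - Cm = raw_demand j k / alpha.
Proof.
move=> phk phhk; rewrite /Defs.Pslot (QslotE phhk) phk.
rewrite /price_of /qstar /raw_demand /target.
by field; rewrite gt_eqF.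
Qed.

Variable M : R.
Hypothesis nz_le : forall k, `|nz k| <= M.
Hypothesis truthful : forall k, exists j, ph k = phis j /\ phh k = phis j.

Lemma reportsP j k : reports j k = 0 \/
  [/\ reports j k = 1, ph k = phis j & phh k = phis j].
Proof.
rewrite /reports; have [phhk|] := eqVneq (phh k) (phis j); last by left.
by right; have [i [-> e]] := truthful k; rewrite -e phhk.
Qed.

Lemma reports_ge0 j k : 0 <= reports j k.
Proof. by rewrite /reports ler0n. Qed.

(** Each demand is at least its noise, since a positive part is nonnegative. This caps the upward
    push of the quote rule; the downward push is capped by the positive part itself. *)
Lemma Dbar_ge j t : - (M + `|Dbar0 j|) <= Dbar j t.
Proof.
have M0 : 0 <= M by apply: le_trans (nz_le 0%N).
rewrite DbarE; case: ifPn => [_|n0].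
  by have := lerNnormlW (lexx `|Dbar0 j|); lra.
have {}n0 : 0 < \sum_(k < t) reports j k.
  by rewrite lt_def n0 sumr_ge0// => k _; exact: reports_ge0.
rewrite ler_pdivlMr// mulr_sumr ler_sum// => k _.
have [->|[-> phk phhk]] := reportsP j k; first by rewrite mulr0 mul0r.
rewrite (DslotE phk phhk) mulr1 mul1r.
have : 0 <= xplus (raw_demand j k) by rewrite le_max lexx.
have := nz_le k; have := normr_ge0 (Dbar0 j).
by rewrite ler_norml => ? /andP[]; lra.
Qed.

(** The noise-free deviation of a slot reporting [j]; its partial sums are the [G] of
    [sublinear_restoring]. *)
Let drift j k := reports j k * (xplus (raw_demand j k) - target j).

Lemma sum_demand_deviation j t :
  \sum_(k < t) reports j k * (Dslot k - target j) =
  \sum_(k < t) reports j k * nz k + \sum_(k < t) drift j k.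
Proof.
rewrite -big_split/=; apply: eq_bigr => k _; rewrite /drift.
have [->|[-> phk phhk]] := reportsP j k; first by rewrite !mul0r addr0.
by rewrite (DslotE phk phhk); ring.
Qed.

(** Gives a nonzero accumulated deviation the sign of [Dbar j t - target j], to which the quote
    reacts. Before the first report both sides are 0, whatever [Dbar0 j]. *)
Lemma sum_demand_deviationE j t :
  \sum_(k < t) reports j k * (Dslot k - target j) =
  (\sum_(k < t) reports j k) * (Dbar j t - target j).
Proof.
rewrite DbarE; case: ifPn => [/eqP n0|n0]; last first.
  rewrite mulrBr mulrCA divff// mulr1 mulr_suml -sumrB.
  by apply: eq_bigr => k _; rewrite mulrBr.
rewrite n0 mul0r big1// => k _; apply/eqP; rewrite mulf_eq0; apply/orP; left.
by apply/eqP; apply: (psumr_eq0P _ n0) => // i _; exact: reports_ge0.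
Qed.

Lemma sublinear_demand_deviation j :
  sublinear (fun t => \sum_(k < t) reports j k * nz k) ->
  sublinear (fun t => \sum_(k < t) reports j k * (Dslot k - target j)).
Proof.
move=> subZ; apply: (eq_sublinear (fun t => esym (sum_demand_deviation j t))).
have c0 : 0 <= alpha * pen by rewrite mulr_ge0// ltW.
have M0 : 0 <= M by apply: le_trans (nz_le 0%N).
have m0 := target_gt0 j.
(* A drift is at least [- target j], and [Dbar_ge] bounds it above by the second summand; [K]
   dominates both. *)
pose K := target j + alpha * pen * (M + `|Dbar0 j| + target j).
have mK : target j <= K by rewrite lerDl mulr_ge0 ?addr_ge0 ?(ltW m0).
have K0 : 0 <= K by lra.
apply: (sublinear_restoring K0) => //.
- by rewrite big_ord0.
- move=> t; rewrite big_ord_recr/= addrAC subrr add0r /drift.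
  have [->|[-> _ _]] := reportsP j t; first by rewrite mul0r normr0.
  rewrite mul1r /xplus /raw_demand.
  have : - (K - target j) <= alpha * pen * (Dbar j t - target j).
    rewrite /K addrAC subrr add0r -mulrN ler_wpM2l//.
    by have := Dbar_ge j t; lra.
  set y := alpha * pen * _ => Ky; rewrite ler_norml.
  by have [|] := leP 0 (target j - y); lra.
(* Here [Dbar j t] exceeds [target j], so the raw demand is at most [target j], and so is its
   positive part because [target j > 0]. *)
- move=> t; rewrite -sum_demand_deviation sum_demand_deviationE => ne0.
  have e0 : 0 < Dbar j t - target j.
    rewrite ltNge; apply/negP => e0; move: ne0; apply/negP; rewrite -leNgt.
    by rewrite mulr_ge0_le0// sumr_ge0// => k _; exact: reports_ge0.
  rewrite big_ord_recr/= gerDl /drift mulr_ge0_le0 ?reports_ge0// subr_le0.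
  by rewrite ge_max ltW// gerBl mulr_ge0// ltW.
- move=> t; rewrite -sum_demand_deviation sum_demand_deviationE => ne0.
  have e0 : Dbar j t - target j < 0.
    rewrite ltNge; apply/negP => e0; move: ne0; apply/negP; rewrite -leNgt.
    by rewrite mulr_ge0// sumr_ge0// => k _; exact: reports_ge0.
  rewrite big_ord_recr/= lerDl /drift mulr_ge0 ?reports_ge0// subr_ge0.
  by rewrite le_max lerDl oppr_ge0 (mulr_ge0_le0 c0 (ltW e0)) orbT.
Qed.

(** * Limits of the demand averages and of the revenue rate *)

Variable sigma : 'I_L -> R.
Hypothesis sigma_gt0 : forall j, 0 < sigma j.
Hypothesis frequency :
  forall j, sublinear (fun t => \sum_(k < t) (reports j k - sigma j)).
Hypothesis noise_average :
  forall j, sublinear (fun t => \sum_(k < t) reports j k * nz k).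

(** A deviation of order o(t) is divided by the number of reports of [j], which grows like
    [sigma j * t]. *)
Lemma cvg_Dbar j : Dbar j t @[t --> \oo] --> target j.
Proof.
have sub0 := sigma_gt0 j.
have freq : t%:R^-1 * \sum_(k < t) reports j k @[t --> \oo] --> sigma j.
  have := cvg_div_sublinear (frequency j).
  move=> /(cvgD (cvg_cst (sigma j))); rewrite addr0; apply: cvg_trans.
  apply: near_eq_cvg; near=> t.
  have t0 : t%:R != 0 :> R.
    by rewrite pnatr_eq0 -lt0n; near: t; exact: nbhs_infty_gt.
  by rewrite !fctE sumrB sumr_const card_ord -mulr_natl; field.
apply/subr_cvg0.
have := cvg_div_sublinear (sublinear_demand_deviation (noise_average j)).
move=> /(cvgM (cvgV (lt0r_neq0 sub0) freq)); rewrite mulr0; apply: cvg_trans.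
apply: near_eq_cvg; near=> t.
have t0 : t%:R != 0 :> R.
  by rewrite pnatr_eq0 -lt0n; near: t; exact: nbhs_infty_gt.
have n0 : 0 < t%:R^-1 * \sum_(k < t) reports j k.
  by near: t; apply: (cvgr_gt _ freq).
rewrite /= sum_demand_deviationE; field.
rewrite t0/=; apply: contraTN n0 => /eqP ->.
by rewrite mulr0 ltxx.
Unshelve. all: by end_near. Qed.

(** What is left of the revenue of a slot reporting [j] after removing [target j ^+ 2 / alpha] and
    [target j * nz k / alpha]. Each term has a factor controlled by [Dbar j k - target j], and so
    tends to 0 although the noise is merely bounded. *)
Let fluctuation j k := reports j k *
  (((xplus (raw_demand j k) - target j) * raw_demand j k -
    (target j + nz k) * (alpha * pen * (Dbar j k - target j))) / alpha).

Lemma cvg_fluctuation j : fluctuation j k @[k --> \oo] --> (0 : R).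
Proof.
have c0 : 0 <= alpha * pen by rewrite mulr_ge0// ltW.
have M0 : 0 <= M by apply: le_trans (nz_le 0%N).
have m0 := target_gt0 j.
pose y k := alpha * pen * (Dbar j k - target j).
have y0 : `|y k| @[k --> \oo] --> (0 : R).
  apply/norm_cvg0P; rewrite -[X in _ --> X](mulr0 (alpha * pen)).
  by apply: cvgM; [exact: cvg_cst|apply/subr_cvg0; exact: cvg_Dbar].
have b0 : `|y k| * ((`|y k| + 2 * target j + M) / alpha) @[k --> \oo]
    --> (0 : R).
  rewrite -[X in _ --> X](mul0r ((0 + 2 * target j + M) / alpha)).
  apply: cvgM => //; apply: cvgM; last exact: cvg_cst.
  apply: cvgD; last exact: cvg_cst.
  by apply: cvgD => //; exact: cvg_cst.
apply/norm_cvg0P; apply: squeeze_cvgr (cvg_cst 0) b0.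
near=> k; rewrite normr_ge0/= /fluctuation.
have [->|[-> _ _]] := reportsP j k.
  rewrite mul0r normr0 mulr_ge0// divr_ge0 ?ltW//.
  by have := normr_ge0 (y k); lra.
rewrite mul1r normrM normfV (gtr0_norm alpha_gt0) [leRHS]mulrA.
rewrite ler_pM2r ?invr_gt0// -/(y k).
rewrite (le_trans (ler_normB _ _))//.
rewrite [`|_ * raw_demand j k|]normrM [`|_ * y k|]normrM.
(* The positive part is 1-Lipschitz and fixes [target j > 0]. *)
have x1 : `|xplus (raw_demand j k) - target j| <= `|y k|.
  rewrite /xplus /raw_demand -/(y k) ler_norml.
  have := ler_norm (y k); have := ler_norm (- y k); rewrite normrN.
  by have [|] := leP 0 (target j - y k); lra.
have x2 : `|raw_demand j k| <= target j + `|y k|.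
  by rewrite (le_trans (ler_normB _ _))// gtr0_norm.
have x3 : `|target j + nz k| <= target j + M.
  by rewrite (le_trans (ler_normD _ _))// gtr0_norm// lerD2l.
have x4 : `|xplus (raw_demand j k) - target j| * `|raw_demand j k| <=
  `|y k| * (target j + `|y k|) by rewrite ler_pM.
have x5 : `|target j + nz k| * `|y k| <= (target j + M) * `|y k|.
  by rewrite ler_wpM2r.
by lra.
Unshelve. all: by end_near. Qed.

Lemma cvg_revenue_rate :
  revenue_rate alpha Cm Cs pen phis Dbar0 ph phh nz t @[t --> \oo] -->
  \sum_j sigma j * (target j ^+ 2 / alpha).
Proof.
set V := \sum_j _.
have revenueE k : Dslot k * (Pslot k - Qslot k - Cm) =
    \sum_j reports j k *
      ((xplus (raw_demand j k) + nz k) * (raw_demand j k / alpha)).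
  have [j [phk phhk]] := truthful k.
  rewrite (bigD1 j)//= big1 => [|i ij]; last first.
    rewrite /reports phhk (_ : _ == _ = false) ?mul0r//.
    by apply/negbTE; rewrite (inj_eq phis_inj) eq_sym.
  rewrite addr0 (DslotE phk phhk) (marginE phk phhk).
  by rewrite /reports phhk eqxx mul1r.
have revenue_sub : sublinear
    (fun t => \sum_(k < t) (Dslot k * (Pslot k - Qslot k - Cm) - V)).
  (* Three errors per type: the frequency of the reports, the averaged noise, and the Cesaro mean of
     [fluctuation]. *)
  have subj j := sublinearD (sublinearD
    (sublinearZ (target j ^+ 2 / alpha) (frequency j))
    (sublinearZ (target j / alpha) (noise_average j)))
    (cesaro_sublinear (@cvg_fluctuation j)).
  apply: eq_sublinear (sublinear_sum (index_enum 'I_L) subj) => t /=.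
  under eq_bigr do rewrite !mulr_sumr -!big_split/=.
  rewrite exchange_big/=; apply: eq_bigr => k _.
  rewrite revenueE /V -sumrB; apply: eq_bigr => j _.
  rewrite /fluctuation /raw_demand; field.
  by rewrite gt_eqF.
have := cvg_div_sublinear revenue_sub.
move=> /(cvgD (cvg_cst V)); rewrite addr0; apply: cvg_trans.
apply: near_eq_cvg; near=> t.
have t0 : t%:R != 0 :> R.
  by rewrite pnatr_eq0 -lt0n; near: t; exact: nbhs_infty_gt.
by rewrite !fctE /revenue_rate sumrB sumr_const card_ord -mulr_natl; field.
Unshelve. all: by end_near. Qed.

End TruthfulPath.

(** * Almost sure conclusions on the probability space *)

Theorem theorem2
  (R : realType) (alpha Cm Cs pen : R) (L : nat)
  (phis : 'I_L -> R) (sigma : 'I_L -> R) (Dbar0 : 'I_L -> R)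
  (d : measure_display) (T : measurableType d) (P : probability T R)
  (Phi Phihat N : nat -> T -> R) :
  0 < alpha -> alpha <= 1 -> 0 <= Cm -> 0 <= Cs ->
  (forall i j : 'I_L, (i < j)%N -> phis i < phis j) ->
  (forall i, 0 < sigma i) -> \sum_(i < L) sigma i = 1 ->
  (forall i : 'I_L, nat_of_ord i = 0%N -> alpha * (Cs + Cm) < phis i) ->
  (* measurability *)
  (forall t, measurable_fun setT (Phi t)) ->
  (forall t, measurable_fun setT (Phihat t)) ->
  (forall t, measurable_fun setT (N t)) ->
  (* joint law of (Phi_t, hat Phi_t) with r = r^id (identity matrix) *)
  (forall t (i j : 'I_L),
     P [set w | Phi t w = phis i /\ Phihat t w = phis j]
       = (sigma i * (1%:M : 'M[R]_L) i j)%:E) ->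
  (* pairs i.i.d. (identical law above), noises i.i.d., noises
     independent of the pairs: the whole family is mutually independent *)
  mutually_independent P
    (fun k : nat + nat => match k with
       | inl t => rv_events (fun w => (Phi t w, Phihat t w))
       | inr t => rv_events (N t) end) ->
  (forall t (B : set R), measurable B -> P (N t @^-1` B) = P (N 0 @^-1` B)) ->
  (exists M : R, forall t w, `|N t w| <= M) ->
  (forall t, ('E_P[N t] = 0)%E) ->
  0 <= pen ->
  (forall j : 'I_L,
     {ae P, forall w,
       Dbar alpha Cm Cs pen phis Dbar0 (fun k => Phi k w) (fun k => Phihat k w)
            (fun k => N k w) j t @[t --> \oo]
       --> (Num.sqrt alpha * hh alpha Cm Cs phis j j : R)}) /\
  {ae P, forall w,
     revenue_rate alpha Cm Cs pen phis Dbar0 (fun k => Phi k w)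
       (fun k => Phihat k w) (fun k => N k w) t @[t --> \oo]
     --> ((16 * alpha)^-1 *
         \sum_(i < L) sigma i * (phis i - alpha * (Cs + Cm)) ^+ 2 : R)}.
Proof.
move=> alpha0 _ _ _ phis_lt sigma0 sigma1 phis0 mPhi mPhihat mN law indep _.
move=> [M NM] EN0 pen0.
have phis_inj : injective phis.
  move=> i j ij; apply/val_inj; have [lt|lt|//] := ltngtP i j.
    by have := phis_lt _ _ lt; rewrite ij ltxx.
  by have := phis_lt _ _ lt; rewrite ij ltxx.
(* The lower bound is assumed for the least potential; monotonicity carries it to all [j]. *)
have target0 j : 0 < target alpha Cm Cs phis j.
  rewrite divr_gt0// subr_gt0.
  have L0 : (0 < L)%N by apply: leq_ltn_trans (ltn_ord j).
  have := phis0 (Ordinal L0) erefl.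
  have [->//|jneq] := eqVneq j (Ordinal L0).
  move=> /lt_trans; apply; apply: phis_lt => /=.
  by rewrite lt0n; apply: contraNneq jneq => j0; apply/eqP/val_inj.
pose X t w := (Phi t w, Phihat t w).
have mX t : measurable_fun setT (X t) by exact: measurable_fun_pair.
pose B j : set (R * R) := [set phis j] `*` [set phis j].
have mB j : measurable (B j) by apply: measurableX; exact: measurable_set1.
have XB j t : P (X t @^-1` B j) = (sigma j)%:E.
  by have := law t j j; rewrite mxE eqxx mulr1.
have bN t : bounded_rv (N t) by split=> //; exists M; exact: NM.
have EN t : \int[P]_w N t w = 0.
  by have := EN0 t; rewrite unlock /Rintegral => ->.
have freq j := strong_law_frequency mX indep (mB j) (XB j).
have noise j := strong_law_noise mX indep (mB j) bN NM EN.
have truth : {ae P, forall w, forall t, exists j, (X t @^-1` B j) w}.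
  apply: ae_foralln => t; apply: ae_exists_of_sum1.
  - by move=> j; rewrite -[_ @^-1` _]setTI; exact: mX.
  - move=> i j _ _ [w [[/= wi _] [/= wj _]]].
    by apply: phis_inj; rewrite -wi -wj.
  - by under eq_bigr do rewrite XB; rewrite sumEFin sigma1.
pose averages j w :=
  sublinear (fun t => \sum_(k < t) (\1_(X k @^-1` B j) w - sigma j)) /\
  sublinear (fun t => \sum_(k < t) \1_(X k @^-1` B j) w * N k w).
have slln : {ae P, forall w, forall j, averages j w}.
  (* Indexing by natural numbers gives a countable intersection of almost sure events. *)
  have : {ae P, forall w, forall n (j : 'I_L), j = n :> nat -> averages j w}.
    apply: ae_foralln => n; have [Ln|nL] := leqP L n.
      by apply: aeW => w j jn; have := ltn_ord j; rewrite jn ltnNge Ln.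
    apply: filterS2 (freq (Ordinal nL)) (noise (Ordinal nL)) => w fw nw j jn.
    by have -> : j = Ordinal nL by exact/val_inj.
  by apply: filterS => w + j; apply.
have path w : (forall t, exists j, (X t @^-1` B j) w) ->
    (forall j, averages j w) ->
  [/\ forall k, exists j, Phi k w = phis j /\ Phihat k w = phis j,
      forall j, sublinear (fun t =>
        \sum_(k < t) (reports phis (Phihat^~ w) j k - sigma j)) &
      forall j, sublinear (fun t =>
        \sum_(k < t) reports phis (Phihat^~ w) j k * N k w)].
  move=> tw sw.
  (* On a truthful path the report alone decides whether the pair lies in [B j]. *)
  have reportE j k : \1_(X k @^-1` B j) w = reports phis (Phihat^~ w) j k.
    rewrite indicE /reports; congr ((nat_of_bool _)%:R); apply/idP/idP.
      by rewrite inE => -[_ /= ->].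
    move=> /eqP wj; rewrite inE; have [i [/= Phii Phihati]] := tw k.
    by have <- : i = j by apply: phis_inj; rewrite -Phihati.
  split=> [k|j|j]; first by have [j [? ?]] := tw k; exists j.
  - apply: eq_sublinear (proj1 (sw j)) => t.
    by apply: eq_bigr => k _; rewrite reportE.
  - apply: eq_sublinear (proj2 (sw j)) => t.
    by apply: eq_bigr => k _; rewrite reportE.
split=> [j|].
  apply: filterS2 truth slln => w tw sw.
  have [tw' fw nw] := path w tw sw.
  rewrite sqrt_hhE//.
  exact: (cvg_Dbar Dbar0 alpha0 pen0 phis_inj target0 (NM^~ w) tw'
    sigma0 fw nw).
apply: filterS2 truth slln => w tw sw.
have [tw' fw nw] := path w tw sw.
have := cvg_revenue_rate Dbar0 alpha0 pen0 phis_inj target0 (NM^~ w) tw'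
  sigma0 fw nw.
rewrite [X in _ --> X -> _](_ : _ = (16 * alpha)^-1 *
  \sum_(i < L) sigma i * (phis i - alpha * (Cs + Cm)) ^+ 2); first by apply.
rewrite mulr_sumr; apply: eq_bigr => i _; rewrite /target; field.
by rewrite gt_eqF.
Qed.
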